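(* Let $\mathcal{I}_k=[0,b_k)$, $0<b_k\le\infty$ ($k=1,2$), and let $G$ and $F$ be polynomials in $z$, $$G(x,t,z)=-\sum_{k=0}^rz^kq_k(x,t),\qquad F(x,t,z)=-\sum_{s=0}^Rz^sQ_s(x,t),$$ whose coefficients are $m\times m$ matrix functions on $\mathcal{I}_1\times\mathcal{I}_2$ such that the $q_k$ are differentiable with respect to $t$, the $Q_s$ are differentiable with respect to $x$, the matrix functions $q_k$, $Q_s$ and $\frac{\partial}{\partial t}q_k$ are continuous with respect to $x$ and $t$, and the zero curvature equation $G_t-F_x+[G,F]=0$ holds on $\mathcal{I}_1\times\mathcal{I}_2$. Let $A_1$ be an $n\times n$ matrix. Then the equations $$(\Pi_1)_x=\sum_{k=0}^rA_1^k\Pi_1q_k,\qquad (\Pi_1)_t=\sum_{s=0}^RA_1^s\Pi_1Q_s,$$ which determine the $n\times m$ matrix function $\Pi_1(x,t)$ from its initial value $\Pi_1(0,0)$, are compatible on $\mathcal{I}_1\times\mathcal{I}_2$.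
   Context: All matrices are complex, $n\in\mathbb{N}$; $[G,F]:=GF-FG$; subscripts $x,t$ attached to $G$, $F$, $\Pi_1$ (other than the index in $\Pi_1$ itself) denote partial derivatives (one-sided at boundary points); the zero curvature equation is assumed for all values of the spectral parameter $z\in\mathbb{C}$. Two equations for $(\Pi_1)_x$ and $(\Pi_1)_t$ are called compatible if for every initial value $\Pi_1(0,0)\in\mathbb{C}^{n\times m}$ there is a matrix function $\Pi_1(x,t)$ on $\mathcal{I}_1\times\mathcal{I}_2$ with this initial value which satisfies both equations simultaneously. *)

(* Defs.v *)
From HB Require Import structures.
From mathcomp Require Import all_boot all_order all_algebra.
From mathcomp Require Import all_classical all_reals all_analysis.
From mathcomp Require Import complex.
Set Implicit Arguments.
Unset Strict Implicit.
Unset Printing Implicit Defensive.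
Import Order.TTheory GRing.Theory Num.Theory.
Import numFieldNormedType.Exports.
Local Open Scope classical_set_scope.
Local Open Scope ring_scope.
Local Open Scope complex_scope.

(* Packing R[i] as a numClosedFieldType lets numFieldNormedType.Exports equip
   the field, and hence matrices over it, with the topology of the modulus. *)
Definition Cplx (R : realType) : numClosedFieldType := R[i].

Definition realC (R : realType) (r : R) : Cplx R := r%:C.

Definition itv0 (R : realType) (b : \bar R) : set R :=
  [set x | 0 <= x /\ (x%:E < b)%E].

(* Derivatives of matrix functions of a real variable, taken along D: the
   increments are restricted to y in D, y != x, so that the derivative is
   one-sided at an endpoint of D that belongs to D. *)
Definition slope (R : realType) (m n : nat) (f : R -> 'M[Cplx R]_(m, n))
    (x y : R) : 'M[Cplx R]_(m, n) :=
  realC (y - x)^-1 *: (f y - f x).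

Definition derivable_in (R : realType) (m n : nat) (D : set R)
    (f : R -> 'M[Cplx R]_(m, n)) (x : R) : Prop :=
  cvg (slope f x y @[y --> within D x^']).

Definition derive_in (R : realType) (m n : nat) (D : set R)
    (f : R -> 'M[Cplx R]_(m, n)) (x : R) : 'M[Cplx R]_(m, n) :=
  lim (slope f x y @[y --> within D x^']).

Definition jointly_continuous (R : realType) (m n : nat) (D1 D2 : set R)
    (f : R -> R -> 'M[Cplx R]_(m, n)) : Prop :=
  {within D1 `*` D2, continuous (fun p : R * R => f p.1 p.2)}.

Definition neg_pencil (R : realType) (m d : nat)
    (q : 'I_d.+1 -> R -> R -> 'M[Cplx R]_m) (x t : R) (z : Cplx R) :
    'M[Cplx R]_m :=
  - \sum_(k < d.+1) z ^+ k *: q k x t.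

Definition mxcomm (R : realType) (m : nat) (G F : 'M[Cplx R]_m) :
    'M[Cplx R]_m := G *m F - F *m G.

Definition zero_curvature (R : realType) (m : nat) (D1 D2 : set R)
    (G F : R -> R -> Cplx R -> 'M[Cplx R]_m) : Prop :=
  forall (x t : R) (z : Cplx R), D1 x -> D2 t ->
    derive_in D2 (fun t' => G x t' z) t - derive_in D1 (fun x' => F x' t z) x
      + mxcomm (G x t z) (F x t z) = 0.

(* Compatibility of the equations  P_x = Phi x t P  and  P_t = Psi x t P. *)
Definition compatible (R : realType) (n m : nat) (D1 D2 : set R)
    (Phi Psi : R -> R -> 'M[Cplx R]_(n, m) -> 'M[Cplx R]_(n, m)) : Prop :=
  forall P0 : 'M[Cplx R]_(n, m), exists P : R -> R -> 'M[Cplx R]_(n, m),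
    P 0 0 = P0 /\
    forall x t : R, D1 x -> D2 t ->
      [/\ derivable_in D1 (fun x' => P x' t) x,
          derive_in D1 (fun x' => P x' t) x = Phi x t (P x t),
          derivable_in D2 (fun t' => P x t') t &
          derive_in D2 (fun t' => P x t') t = Psi x t (P x t)].

(* Main.v *)
Require Import Defs.
From HB Require Import structures.
From mathcomp Require Import all_boot all_order all_algebra.
From mathcomp Require Import all_classical all_reals all_analysis.
From mathcomp Require Import complex.
From mathcomp Require Import ring lra.
Set Implicit Arguments.
Unset Strict Implicit.
Unset Printing Implicit Defensive.
Import Order.TTheory GRing.Theory Num.Theory.
Import numFieldNormedType.Exports.
Local Open Scope classical_set_scope.
Local Open Scope ring_scope.

(** Write the two equations as linear systems [P_x = a P] and [P_t = b P], where
[a] and [b] are the operators [P |-> sum A1^k P q_k] and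
[P |-> sum A1^k P Q_k]. The zero curvature equation is a polynomial identity in
[z]; as it holds for every [z], its matrix coefficients vanish, and [z] may be
replaced by [A1] ([pencil_eq0_subst]). The result is the flatness
[a_t + a b = b_x + b a] ([pencil_op_flat]), the integrability condition obtained
by equating the two mixed derivatives of [P].

Flatness suffices for a common solution ([frobenius]). Solve the [x]-system on
the edge [t = 0] with the given initial value, then the [t]-system on every line
[x = const] ([linear_ode]). It remains to see that the resulting [P] satisfies
the [x]-system for [t > 0] as well ([frobenius_x]). As [a] is differentiable in
[t] only and [b] in [x] only, second derivatives of [P] are avoided: for fixed [x]
and an increment [h], the remainder [r = P(x + h, t) - P(x, t) - h a P(x, t)]
satisfies, by flatness, a linear equation in [t] whose inhomogeneity and initial
value are [o(h)] uniformly on compact intervals of [t]. The Gronwall inequality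
([gronwall]) yields [r = o(h)], that is, [P_x = a P]. The uniformity rests on
the joint continuity of [b_x], which flatness expresses through [a], [b] and
[a_t].

The analysis takes place in the real coordinates of the complex matrices, where
both systems have real coefficients and convergence of matrices is convergence of
every coordinate ([mx_cvgP]). Derivatives are taken along [0, b), hence one-sided
at [0]. *)

(** * Derivatives of real functions along a set *)

Section OneVariable.
Variable R : realType.
Implicit Types (D : set R) (f g : R -> R) (x l : R).

Definition has_deriv D f x l : Prop :=
  (f y - f x) / (y - x) @[y --> within D x^'] --> l.

(** Form of the derivative in which the quotient is cleared: the point [y = x]
needs no exclusion, and the estimates below combine by the triangle inequality. *)
Lemma has_derivP D f x l : has_deriv D f x l <->
  forall e, 0 < e -> \forall y \near x,
    D y -> `|f y - f x - l * (y - x)| <= e * `|y - x|.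
Proof.
split=> [/cvgrPdist_le fl e e0|H].
  have := fl e e0; rewrite !near_withinE => H; near=> y => Dy.
  have [->|yx] := eqVneq y x; first by rewrite !subrr mulr0 subrr normr0 mulr0.
  have /(_ yx Dy) : y != x -> D y -> `|l - (f y - f x) / (y - x)| <= e.
    by near: y.
  have yx0 : y - x != 0 by rewrite subr_eq0.
  rewrite distrC -(ler_pM2r (x := `|y - x|)) ?normr_gt0//.
  by rewrite -normrM mulrBl divfK.
apply/cvgrPdist_le => e e0; rewrite !near_withinE.
apply: filterS (H e e0) => y Hy yx Dy.
have yx0 : y - x != 0 by rewrite subr_eq0.
rewrite distrC -(ler_pM2r (x := `|y - x|)) ?normr_gt0//.
by rewrite -normrM mulrBl divfK//; exact: Hy.
Unshelve. all: by end_near. Qed.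

Lemma has_deriv_cvg D f x l :
  has_deriv D f x l -> f y @[y --> within D (nbhs x)] --> f x.
Proof.
move/has_derivP/(_ 1 ltr01) => H.
apply/cvgrPdist_le => e e0; rewrite near_withinE.
have k0 : 0 < 1 + `|l| by rewrite ltr_pwDl.
near=> y => Dy.
have Hy : D y -> `|f y - f x - l * (y - x)| <= 1 * `|y - x| by near: y.
rewrite distrC -(subrK (l * (y - x)) (f y - f x)).
apply: (le_trans (ler_normD _ _)); rewrite normrM.
apply: (@le_trans _ _ ((1 + `|l|) * `|y - x|)).
  by rewrite mulrDl lerD2r; exact: Hy.
rewrite mulrC -ler_pdivlMr// distrC; near: y.
by apply: (@cvgr_dist_le _ _ _ _ _ id x) => //; exact: divr_gt0.
Unshelve. all: by end_near. Qed.

Lemma has_deriv_cst D (c x : R) : has_deriv D (fun=> c) x 0.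
Proof.
rewrite /has_deriv; under eq_fun do rewrite subrr mul0r; exact: cvg_cst.
Qed.

Lemma has_derivD D f g x l l' : has_deriv D f x l -> has_deriv D g x l' ->
  has_deriv D (fun y => f y + g y) x (l + l').
Proof.
move=> fl gl; rewrite /has_deriv.
rewrite (_ : (fun y => _) = (fun y => (f y - f x) / (y - x) + (g y - g x) / (y - x))).
  exact: cvgD.
by apply/funext => y; rewrite -mulrDl opprD addrACA.
Qed.

Lemma has_derivM D f g x l l' : has_deriv D f x l -> has_deriv D g x l' ->
  has_deriv D (fun y => f y * g y) x (l * g x + f x * l').
Proof.
move=> fl gl; rewrite /has_deriv.
rewrite (_ : (fun y => _) =
   (fun y => (f y - f x) / (y - x) * g y + f x * ((g y - g x) / (y - x)))).
  apply: cvgD; last by apply: cvgMr.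
  apply: cvgM => //; apply: cvg_trans (has_deriv_cvg gl).
  apply: cvg_app => A H.
  have {}H : (nbhs x) [set y | D y -> A y] := H.
  suff : (x^') [set y | D y -> A y] by [].
  by apply: (@filterS _ (nbhs x) _ _ _ _ H) => y Hy _.
by apply/funext => y; lra.
Qed.

Lemma has_derivZ D f c x l : has_deriv D f x l ->
  has_deriv D (fun y => c * f y) x (c * l).
Proof.
move=> fl; have := has_derivM (has_deriv_cst D c x) fl.
by rewrite mul0r add0r.
Qed.

Lemma has_derivB D f g x l l' : has_deriv D f x l -> has_deriv D g x l' ->
  has_deriv D (fun y => f y - g y) x (l - l').
Proof.
move=> fl /(has_derivZ (c := -1)) gl; have := has_derivD fl gl.
rewrite mulN1r; congr has_deriv; apply/funext => y; by rewrite mulN1r.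
Qed.

Lemma has_deriv_sum D (I : Type) (r : seq I) (P : pred I) (f : I -> R -> R)
    (l : I -> R) x :
  (forall i, P i -> has_deriv D (f i) x (l i)) ->
  has_deriv D (fun y => \sum_(i <- r | P i) f i y) x (\sum_(i <- r | P i) l i).
Proof.
move=> H; elim: r => [|i r IH].
  rewrite big_nil; have := has_deriv_cst D 0 x; congr has_deriv.
  by apply/funext => y; rewrite big_nil.
rewrite big_cons; case: ifPn => Pi; last first.
  by move: IH; congr has_deriv; apply/funext => y; rewrite big_cons (negbTE Pi).
have := has_derivD (H i Pi) IH; congr has_deriv.
by apply/funext => y; rewrite big_cons Pi.
Qed.

(** The next two lemmas give access to two-sided differential calculus: at interior
points of [D] the two notions agree, and only the left endpoint of an interval
needs separate care. *)
Lemma is_derive_has_deriv D f x l : is_derive x 1 f l -> has_deriv D f x l.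
Proof.
move=> [df fl]; apply/has_derivP => e e0.
have : h^-1 *: (f (h *: 1 + x) - f x) @[h --> 0^'] --> l by rewrite -fl.
move/cvgrPdist_le => /(_ e e0); rewrite near_withinE.
move=> /nbhs_ballP[d /= d0 H]; apply/nbhs_ballP; exists d => //= y xy _.
have [->|yx] := eqVneq y x; first by rewrite !subrr mulr0 subrr normr0 mulr0.
have yx0 : y - x != 0 by rewrite subr_eq0.
have := H (y - x); rewrite /ball/= sub0r normrN distrC -/(ball x d y).
move=> /(_ xy yx0).
rewrite /GRing.scale/= mulr1 subrK.
rewrite -(ler_pM2r (x := `|y - x|)) ?normr_gt0// -normrM mulrBl.
by rewrite mulrAC mulVf// mul1r (distrC (l * _)) (distrC x).
Qed.

Lemma has_deriv_is_derive D f x l : D° x -> has_deriv D f x l ->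
  is_derive x 1 f l.
Proof.
move=> Dx /has_derivP fl.
have H : h^-1 *: (f (h *: 1 + x) - f x) @[h --> 0^'] --> l.
  apply/cvgrPdist_le => e e0; rewrite near_withinE.
  have /nbhs_ballP[d /= d0 H] := fl e e0.
  have /nbhs_ballP[d' /= d'0 H'] := Dx.
  apply/nbhs_ballP; exists (Num.min d d') => /=; first by rewrite lt_min d0.
  move=> h; rewrite /ball/= sub0r normrN lt_min => /andP[hd hd'] h0.
  have := H (h + x); rewrite /ball/= opprD addrCA subrr addr0 normrN.
  move=> /(_ hd); rewrite addrK.
  have Dh : D (h + x).
    by apply: H'; rewrite /ball/= opprD addrCA subrr addr0 normrN.
  move=> /(_ Dh); rewrite /GRing.scale/= mulr1.
  rewrite distrC => Hh; rewrite -(ler_pM2r (x := `|h|)) ?normr_gt0//.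
  by rewrite -normrM mulrBl [h^-1 * _ * _]mulrAC mulVf// mul1r.
split; first by apply/cvg_ex; exists l.
exact: (cvg_lim _ H).
Qed.
End OneVariable.

(** * Calculus on a half-open interval *)

Section HalfOpenInterval.
Variable R : realType.
Implicit Types (b : \bar R) (f g : R -> R) (c s t x y : R).

Lemma itv0_le b x y : itv0 b y -> 0 <= x -> x <= y -> itv0 b x.
Proof.
by move=> [_ yb] x0 xy; split => //; apply: le_lt_trans yb; rewrite lee_fin.
Qed.

Lemma itv0_zero b : (0 < b)%E -> itv0 b 0.
Proof. by move=> b0; split. Qed.

Lemma itv0_gt b x : itv0 b x -> exists2 y, x < y & itv0 b y.
Proof.
case: b => [r| |] [x0 xb] //; last by exists (x + 1); [lra|split; [lra|exact: ltry]].
move: xb; rewrite lte_fin => xr; exists ((x + r) / 2); first lra.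
by split; rewrite ?lte_fin; lra.
Qed.

(** Every point of [0, b) is a limit point of [0, b) from the right, which makes
the limit that defines a derivative along [0, b) unique. *)
Lemma itv0_dnbhs_proper b x : itv0 b x -> ProperFilter (within (itv0 b) x^').
Proof.
move=> bx; apply: Build_ProperFilter => H.
have [y xy by_] := itv0_gt bx.
have : \forall z \near x^', itv0 b z -> False by [].
rewrite near_withinE => /nbhs_ballP[d /= d0 Hd].
have z1 : x < x + Num.min (d / 2) (y - x).
  by rewrite ltrDl lt_min subr_gt0 xy divr_gt0.
apply: (Hd (x + Num.min (d / 2) (y - x))).
- rewrite /ball/= opprD addrA subrr sub0r normrN gtr0_norm; last by lra.
  by apply: (@le_lt_trans _ _ (d / 2)); [rewrite ge_min lexx|lra].
- by rewrite gt_eqF.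
- apply: itv0_le by_ _ _; first by move: bx => [? _]; lra.
  by rewrite addrC -lerBrDr ge_min lexx orbT.
Qed.

Lemma itv0_interior b x y : itv0 b y -> 0 < x -> x < y -> (itv0 b)° x.
Proof.
move=> by_ x0 xy; apply/nbhs_ballP; exists (Num.min x (y - x)) => /=.
  by rewrite lt_min x0 subr_gt0.
move=> z; rewrite /ball/= lt_min => /andP[]; rewrite !ltr_norml.
move=> /andP[H1 H2] /andP[H3 H4]; apply: itv0_le by_ _ _; lra.
Qed.

Lemma sub_itv0 b c : itv0 b c -> `[0, c] `<=` itv0 b.
Proof. by move=> bc x /=; rewrite in_itv/= => /andP[? ?]; exact: itv0_le bc _ _. Qed.

Lemma has_deriv_continuous b f (f' : R -> R) :
  (forall t, itv0 b t -> has_deriv (itv0 b) f t (f' t)) ->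
  {within itv0 b, continuous f}.
Proof. by move=> H; apply/subspace_continuousP => x /H/has_deriv_cvg. Qed.

Lemma has_deriv_nonincreasing b f (f' : R -> R) s t :
  0 <= s -> s <= t -> itv0 b t ->
  (forall u, s <= u <= t -> has_deriv (itv0 b) f u (f' u)) ->
  (forall u, s <= u <= t -> f' u <= 0) ->
  f t <= f s.
Proof.
move=> s0; rewrite le_eqVlt => /predU1P[-> //|st bt df f'0].
have fc : {within `[s, t], continuous f}.
  apply/subspace_continuousP => x /=; rewrite in_itv/= => /df/has_deriv_cvg.
  apply: cvg_trans; apply: cvg_app; apply: within_subset => y /=.
  by rewrite in_itv/= => /andP[sy yt]; apply: itv0_le bt _ _ => //; lra.
have fd x : x \in `]s, t[ -> is_derive x 1 f (f' x).
  rewrite in_itv/= => /andP[sx xt]; apply: (@has_deriv_is_derive _ (itv0 b)).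
    by apply: (itv0_interior bt) => //; lra.
  by apply: df; rewrite !ltW.
have [x] := MVT st fd fc; rewrite in_itv/= => /andP[sx xt] E.
rewrite -subr_le0 E mulr_le0_ge0 ?subr_ge0 ?(ltW st)//.
by rewrite f'0// !ltW.
Qed.

(** Mean value inequality with a variable majorant: [g - f] and [g + f] are both
nondecreasing. Exponential majorants are what the Picard iteration needs. *)
Lemma has_deriv_le b f g (f' g' : R -> R) s t :
  0 <= s -> s <= t -> itv0 b t ->
  (forall u, s <= u <= t -> has_deriv (itv0 b) f u (f' u)) ->
  (forall u, s <= u <= t -> has_deriv (itv0 b) g u (g' u)) ->
  (forall u, s <= u <= t -> `|f' u| <= g' u) ->
  `|f t - f s| <= g t - g s.
Proof.
move=> s0 st bt df dg fg; rewrite ler_norml; apply/andP; split.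
  suff : -1 * f t - g t <= -1 * f s - g s by lra.
  apply: (@has_deriv_nonincreasing b (fun u => -1 * f u - g u)
    (fun u => -1 * f' u - g' u)) => // u su.
    by apply: has_derivB; [apply/has_derivZ/df|exact: dg].
  by have := fg u su; rewrite ler_norml => /andP[]; lra.
suff : f t - g t <= f s - g s by lra.
apply: (@has_deriv_nonincreasing b (fun u => f u - g u)
  (fun u => f' u - g' u)) => // u su.
  by apply: has_derivB; [exact: df|exact: dg].
by have := fg u su; rewrite ler_norml => /andP[]; lra.
Qed.

Lemma has_deriv_lipschitz b f (f' : R -> R) (e : R) x y :
  itv0 b x -> itv0 b y ->
  (forall u, Num.min x y <= u <= Num.max x y -> has_deriv (itv0 b) f u (f' u)) ->
  (forall u, Num.min x y <= u <= Num.max x y -> `|f' u| <= e) ->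
  `|f y - f x| <= e * `|y - x|.
Proof.
wlog xy : x y / x <= y => [H|] bx by_ df f'e.
  have [xy|/ltW yx] := leP x y; first exact: H.
  by rewrite distrC (distrC y); apply: H => // u; rewrite minC maxC; [exact: df|exact: f'e].
move: df f'e; rewrite (min_l xy) (max_r xy) => df f'e.
rewrite [leRHS](_ : _ = e * y - e * x); last by rewrite ger0_norm ?subr_ge0//; lra.
apply: (@has_deriv_le b f (fun u => e * u) f' (fun=> e * 1)) => //.
- by case: bx.
- by move=> u _; apply/has_derivZ/is_derive_has_deriv.
- by move=> u su; rewrite mulr1; exact: f'e.
Qed.

Lemma bounded_itv0 b f c : itv0 b c -> {within itv0 b, continuous f} ->
  exists2 K, 0 <= K & forall t, 0 <= t <= c -> `|f t| <= K.
Proof.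
move=> bc fc.
have c0 : 0 <= c by case: bc.
have fc' : {within `[0, c], continuous f}.
  by apply: continuous_subspaceW fc; exact: sub_itv0.
have [x _ Hx] := EVT_max c0 fc'; have [y _ Hy] := EVT_min c0 fc'.
exists (Num.max `|f x| `|f y|); first by rewrite le_max normr_ge0.
move=> t tc; have tc' : t \in `[0, c] by rewrite in_itv.
have := Hx t tc'; have := Hy t tc' => H1 H2; rewrite le_max.
have [f0|f0] := leP 0 (f t).
  by rewrite ger0_norm// (le_trans H2 (ler_norm _)).
rewrite ltr0_norm// -(normrN (f y)); apply/orP; right.
by apply: le_trans (ler_norm _); rewrite lerN2.
Qed.

(** The function is continued to the left of [0] by the constant [f 0], and the
integral starts at [-1], so that [0] is an interior point at which the
two-sided fundamental theorem applies. *)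
Lemma antiderivative b f : (0 < b)%E -> {within itv0 b, continuous f} ->
  exists2 F : R -> R, F 0 = 0 &
    forall t, itv0 b t -> has_deriv (itv0 b) F t (f t).
Proof.
move=> b0 /subspace_continuousP fc.
pose g y := f (Num.max y 0).
have gc y z : itv0 b z -> y < z -> {for y, continuous g}.
  move=> bz yz; apply/cvgrPdist_le => e e0.
  have z0 : 0 <= z by case: bz.
  have by' : y < z -> itv0 b (Num.max y 0).
    by move=> ?; apply: itv0_le bz _ _; rewrite ?le_max ?lexx ?orbT// ge_max z0 ltW.
  have /cvgrPdist_le/(_ e e0) := fc _ (by' yz).
  rewrite near_withinE => /nbhs_ballP[d /= d0 H].
  near=> y'.
  apply: H; last first.
    apply: itv0_le bz _ _; first by rewrite le_max lexx orbT.
    rewrite ge_max z0 andbT ltW//; near: y'.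
    exact: lt_nbhsl.
  have : `|y - y'| < d by near: y'; apply: (@cvgr_dist_lt _ _ _ _ _ id y).
  rewrite /ball/=; apply: le_lt_trans.
  rewrite /Num.max; do 2 case: ltrP => ?; rewrite ?subrr ?normr0//;
    rewrite ler_norml; apply/andP; split;
    have := ler_norm (y - y'); have := ler_norm (y' - y);
    rewrite (distrC y'); lra.
pose mu := @lebesgue_measure R.
pose G t := (\int[mu]_(u in `[(-1), t]) g u)%R.
exists (fun t => G t - G 0); first by rewrite subrr.
move=> t bt.
have -> : f t = f t - 0 by rewrite subr0.
apply: has_derivB; last exact: has_deriv_cst.
have [u tu bu] := itv0_gt bt; have [v uv bv] := itv0_gt bu.
have t0 : 0 <= t by case: bt.
have gi : mu.-integrable `[(-1), u] (EFin \o g).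
  apply: continuous_compact_integrable; first exact: segment_compact.
  apply: continuous_in_subspaceT => y; rewrite inE/= in_itv/= => /andP[_ yu].
  by apply: gc bv _; lra.
have m1t : -1 < t by lra.
have [dG GE] := continuous_FTC1_closed tu gi m1t (gc _ _ bu tu).
apply: is_derive_has_deriv; split => //; move: GE; rewrite derive1E => ->.
by rewrite /g max_l.
Unshelve. all: by end_near. Qed.

End HalfOpenInterval.

(** * Functions that are jointly continuous on a product of intervals *)

Section TwoVariables.
Variables (R : realType) (b1 b2 : \bar R).

Definition cont2 (g : R -> R -> R) : Prop :=
  {within itv0 b1 `*` itv0 b2, continuous (fun p : R * R => g p.1 p.2)}.

Lemma cont2P (g : R -> R -> R) : cont2 g <->
  forall x t, itv0 b1 x -> itv0 b2 t -> forall e : R, 0 < e ->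
  exists2 d : R, 0 < d & forall x' t', itv0 b1 x' -> itv0 b2 t' ->
    `|x' - x| < d -> `|t' - t| < d -> `|g x' t' - g x t| <= e.
Proof.
split=> [/subspace_continuousP gc x t bx bt e e0|H].
  have /cvgrPdist_le/(_ e e0) := gc (x, t) (conj bx bt).
  rewrite near_withinE => /nbhs_ballP[d /= d0 H].
  exists d => // x' t' bx' bt' xd td; rewrite distrC.
  apply: (H (x', t')); last by split.
  by split; rewrite /ball/= distrC.
apply/subspace_continuousP => -[x t] [/= bx bt].
apply/cvgrPdist_le => e e0; rewrite near_withinE.
have [d d0 Hd] := H x t bx bt e e0.
apply/nbhs_ballP; exists d => //= -[x' t'] [/= xd td] [/= bx' bt'].
by rewrite distrC; apply: Hd => //; rewrite distrC.
Qed.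

Lemma cont2_x (g : R -> R -> R) t : cont2 g -> itv0 b2 t ->
  {within itv0 b1, continuous (g^~ t)}.
Proof.
move=> /cont2P gc bt; apply/subspace_continuousP => x bx.
apply/cvgrPdist_le => e e0; rewrite near_withinE.
have [d d0 Hd] := gc x t bx bt e e0.
apply/nbhs_ballP; exists d => //= x' xd bx'.
by rewrite distrC; apply: Hd => //; rewrite 1?distrC// subrr normr0.
Qed.

Lemma cont2_t (g : R -> R -> R) x : cont2 g -> itv0 b1 x ->
  {within itv0 b2, continuous (g x)}.
Proof.
move=> /cont2P gc bx; apply/subspace_continuousP => t bt.
apply/cvgrPdist_le => e e0; rewrite near_withinE.
have [d d0 Hd] := gc x t bx bt e e0.
apply/nbhs_ballP; exists d => //= t' td bt'.
by rewrite distrC; apply: Hd => //; rewrite 1?distrC// subrr normr0.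
Qed.

(** Tube lemma: compactness of [0, c] makes the continuity in [x] uniform in [t]. *)
Lemma cont2_tube (g : R -> R -> R) x c (e : R) : cont2 g -> itv0 b1 x -> itv0 b2 c ->
  0 < e -> exists2 d : R, 0 < d & forall x' t, itv0 b1 x' -> `|x' - x| < d ->
    0 <= t <= c -> `|g x' t - g x t| <= e.
Proof.
move=> /cont2P gc bx bc e0.
have /compact_near_coveringP/near_covering_withinP := @segment_compact R 0 c.
move=> /(_ R (nbhs x)
  (fun x' t => itv0 b1 x' -> `|g x' t - g x t| <= e) _).
case.
  move=> t /=; rewrite in_itv/= => tc.
  have bt : itv0 b2 t by case/andP: tc => ? ?; apply: itv0_le bc _ _.
  have e20 : 0 < e / 2 by rewrite divr_gt0.
  have [d d0 Hd] := gc x t bx bt _ e20.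
  exists (ball t d, ball x d) => /=; first by split; exact: nbhsx_ballx.
  move=> [t' x'] /= [td xd]; rewrite in_itv/= => t'c bx'.
  have bt' : itv0 b2 t' by case/andP: t'c => ? ?; apply: itv0_le bc _ _.
  rewrite /ball/= distrC in td; rewrite /ball/= distrC in xd.
  have H1 := Hd x' t' bx' bt' xd td.
  have H2 : `|g x t' - g x t| <= e / 2 by apply: Hd; rewrite ?subrr ?normr0.
  rewrite -(subrKA (g x t)) (splitr e) (le_trans (ler_normD _ _))//.
  by rewrite lerD// distrC.
move=> d /= d0 Hd; exists d => // x' t bx' xd tc.
by apply: (Hd x'); rewrite /= ?in_itv//= distrC.
Qed.

(** First-order expansion in [x] with a remainder that is small uniformly in [t]:
the mean value inequality applied to [g y t - gx x t * y], whose derivative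
[gx y t - gx x t] is uniformly small by the preceding lemma. *)
Lemma cont2_expansion (g gx : R -> R -> R) x c (e : R) :
  (forall x' t, itv0 b1 x' -> itv0 b2 t -> has_deriv (itv0 b1) (g^~ t) x' (gx x' t)) ->
  cont2 gx -> itv0 b1 x -> itv0 b2 c -> 0 < e ->
  \forall x' \near x, itv0 b1 x' -> forall t, 0 <= t <= c ->
    `|g x' t - g x t - (x' - x) * gx x t| <= e * `|x' - x|.
Proof.
move=> dg gxc bx bc e0; have [d d0 Hd] := cont2_tube gxc bx bc e0.
apply/nbhs_ballP; exists d => //= x'; rewrite /ball/= distrC => xd bx' t tc.
have bt : itv0 b2 t by case/andP: tc => ? ?; apply: itv0_le bc _ _.
have := @has_deriv_lipschitz _ b1 (fun y => g y t - gx x t * y)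
  (fun y => gx y t - gx x t * 1) e x x' bx bx'.
have bu u : Num.min x x' <= u <= Num.max x x' -> itv0 b1 u.
  move=> /andP[mu uM]; apply: (@itv0_le _ b1 _ (Num.max x x')) => //.
    by rewrite /Num.max; case: ifP.
  by apply: le_trans mu; rewrite le_min; case: bx => -> _; case: bx' => ->.
move=> H; rewrite (_ : _ - _ = g x' t - gx x t * x' - (g x t - gx x t * x)); last lra.
apply: H => u /[dup] /bu bu' /andP[mu uM].
  by apply: has_derivB; [exact: dg|apply/has_derivZ/is_derive_has_deriv].
rewrite mulr1; apply: Hd => //; apply: le_lt_trans xd.
move: mu uM; rewrite /Num.min /Num.max; case: ltrP => xx' mu uM.
  by rewrite !ger0_norm ?subr_ge0//; lra.
by rewrite !ler0_norm ?subr_le0//; lra.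
Qed.

End TwoVariables.

(** * Linear differential systems on a half-open interval *)

Lemma has_deriv_expM (R : realType) (D : set R) (L x : R) :
  has_deriv D (fun t => expR (L * t)) x (L * expR (L * x)).
Proof.
apply: is_derive_has_deriv.
have h : is_derive x 1 (fun t => L * t) L.
  have := @is_deriveZ _ R R id L x 1 1 (is_derive_id _ _); rewrite /GRing.scale/= mulr1; exact.
have := @is_derive1_comp R expR (fun t => L * t) x _ _ (is_derive_expR _) h.
by rewrite mulrC.
Qed.

Lemma exists_half_exp_le (R : realType) (B e : R) : 0 < e -> 0 <= B ->
  exists n, B * 2^-1 ^+ n <= e.
Proof.
move=> e0 B0; exists (Num.bound (B / e)).
have := archi_boundP (divr_ge0 B0 (ltW e0)).
set n := Num.bound _ => Hn; rewrite exprVn ler_pdivrMr ?exprn_gt0//.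
rewrite mulrC -ler_pdivrMr// (le_trans (ltW Hn))//.
by rewrite -natrX ler_nat ltnW// ltn_expl.
Qed.

Section LinearSystems.
Variables (R : realType) (I : finType) (b : \bar R).
Hypothesis b0 : (0 < b)%E.
Implicit Types (t u c K L : R).

(** Gronwall inequality with a constant [C] that depends on [c] and [K] alone. The
energy [E], the sum of the squares, satisfies [E' <= L * (E + N * e ^ 2)] with
[N] the number of unknowns, so [(E + N * e ^ 2) * exp (- L u)] is
nonincreasing. Sums of squares are used because they are differentiable,
unlike norms. *)
Lemma gronwall c K : itv0 b c -> 0 <= K -> exists2 C : R, 0 <= C &
  forall (f f' : I -> R -> R) (e : R), 0 <= e ->
  (forall i t, 0 <= t <= c -> has_deriv (itv0 b) (f i) t (f' i t)) ->
  (forall i t, 0 <= t <= c -> `|f' i t| <= K * (\sum_j `|f j t|) + e) ->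
  (forall i, `|f i 0| <= e) ->
  forall i t, 0 <= t <= c -> `|f i t| <= C * e.
Proof.
move=> bc K0; have c0 : 0 <= c by case: bc.
pose N : R := #|I|%:R.
have N0 : 0 <= N by rewrite ler0n.
pose L := 2 * N * K + 1.
have L0 : 0 <= L by rewrite addr_ge0// !mulr_ge0.
pose M := 2 * N * expR (L * c).
have M0 : 0 <= M by rewrite !mulr_ge0// expR_ge0.
exists (1 + M) => [|f f' e e0 df f'le f0 i t tc]; first by rewrite addr_ge0.
pose E u := \sum_j f j u * f j u.
pose E' u := \sum_j (f' j u * f j u + f j u * f' j u).
have dE u : 0 <= u <= c -> has_deriv (itv0 b) E u (E' u).
  by move=> uc; apply: has_deriv_sum => j _; apply: has_derivM; exact: df.
have cN (x : R) : \sum_(j : I) x = N * x.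
  by rewrite sumr_const mulr_natl.
have E'le u : 0 <= u <= c -> E' u <= L * (E u + N * e ^+ 2).
  move=> uc; apply: (@le_trans _ _ (\sum_j (\sum_k K * (f j u * f j u + f k u * f k u)
      + (e ^+ 2 + f j u * f j u)))).
    apply: ler_sum => j _.
    rewrite [f j u * f' j u]mulrC -mulr2n -mulr_natl.
    apply: (@le_trans _ _ (2 * (`|f' j u| * `|f j u|))).
      by rewrite ler_pM2l// -normrM ler_norm.
    apply: (@le_trans _ _ (2 * ((K * (\sum_k `|f k u|) + e) * `|f j u|))).
      by rewrite ler_pM2l// ler_wpM2r// f'le.
    rewrite (mulrDl (K * _)) (mulrDr 2) lerD//.
      rewrite mulr_sumr mulr_suml mulr_sumr ler_sum// => k _.
      rewrite -!expr2 -(real_normK (num_real (f j u))) -(real_normK (num_real (f k u))).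
      rewrite (_ : 2 * _ = K * (2 * (`|f k u| * `|f j u|))); last lra.
      rewrite ler_wpM2l//; have := sqr_ge0 (`|f k u| - `|f j u|).
      by rewrite !expr2; lra.
    rewrite -expr2 -(real_normK (num_real (f j u))).
    have := sqr_ge0 (`|f j u| - e); rewrite !expr2; lra.
  under eq_bigr => j _ do rewrite -mulr_sumr big_split/= cN.
  rewrite big_split/= -mulr_sumr big_split/= -mulr_sumr cN big_split/= cN -/(E u).
  rewrite /L; have : 0 <= N * K * (N * e ^+ 2).
    by rewrite !mulr_ge0// sqr_ge0.
  lra.
have H : (E t + N * e ^+ 2) * expR (- L * t) <= (E 0 + N * e ^+ 2) * expR (- L * 0).
  move: tc => /andP[t0 tc].
  apply: (@has_deriv_nonincreasing _ b (fun u => (E u + N * e ^+ 2) * expR (- L * u))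
   (fun u => (E' u + 0) * expR (- L * u) + (E u + N * e ^+ 2) * (- L * expR (- L * u))))
    => //.
  - exact: itv0_le bc _ _.
  - move=> u /andP[u0 ut]; apply: has_derivM; last exact: has_deriv_expM.
    by apply: has_derivD; [apply: dE; rewrite u0 (le_trans ut)|exact: has_deriv_cst].
  - move=> u /andP[u0 ut]; rewrite addr0 mulrA -mulrDl mulr_le0_ge0 ?expR_ge0//.
    by have := E'le u; rewrite u0 (le_trans ut)// => /(_ isT); lra.
have E0 : E 0 <= N * e ^+ 2.
  rewrite -cN ler_sum// => j _; rewrite -expr2 -(real_normK (num_real (f j 0))).
  by rewrite lerXn2r ?nnegrE.
have Et : E t + N * e ^+ 2 <= M * e ^+ 2.
  move: H; rewrite mulr0 expR0 mulr1 mulNr expRN ler_pdivrMr ?expR_gt0// => H.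
  apply: (le_trans H).
  apply: (@le_trans _ _ ((2 * (N * e ^+ 2)) * expR (L * t))).
    by rewrite ler_wpM2r ?expR_ge0//; lra.
  rewrite (_ : M * _ = 2 * (N * e ^+ 2) * expR (L * c)); last by rewrite /M; ring.
  rewrite ler_wpM2l ?mulr_ge0 ?sqr_ge0// ler_expR ler_wpM2l//.
  by case/andP: tc.
have fE : `|f i t| ^+ 2 <= E t.
  rewrite real_normK ?num_real// /E (bigD1 i)//= expr2 lerDl sumr_ge0// => j _.
  by rewrite -expr2 sqr_ge0.
rewrite -(@ler_pXn2r _ 2%N) ?nnegrE ?mulr_ge0// ?addr_ge0//.
apply: (le_trans fE); rewrite exprMn.
have : 0 <= N * e ^+ 2 by rewrite mulr_ge0// sqr_ge0.
have : 0 <= (1 + M + M ^+ 2) * e ^+ 2 by rewrite mulr_ge0 ?sqr_ge0// !addr_ge0// sqr_ge0.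
rewrite !expr2 in Et *; lra.
Qed.

Lemma continuous_sum (a : I -> I -> R -> R) (y : I -> R -> R) :
  (forall i j, {within itv0 b, continuous (a i j)}) ->
  (forall i, {within itv0 b, continuous (y i)}) ->
  forall i, {within itv0 b, continuous (fun t => \sum_j a i j t * y j t)}.
Proof.
move=> ca cy i; apply/subspace_continuousP => t bt.
apply: cvg_big => [|j _]; first exact: add_continuous.
by apply: cvgM; [move/subspace_continuousP: (ca i j); exact|
  move/subspace_continuousP: (cy j); exact].
Qed.

Lemma bounded_family (J : finType) (f : J -> R -> R) c : itv0 b c ->
  (forall j, {within itv0 b, continuous (f j)}) ->
  exists2 K, 0 <= K & forall j t, 0 <= t <= c -> `|f j t| <= K.
Proof.
move=> bc fc.
have [k kP] : {k : J -> R & forall j, 0 <= k j /\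
    forall t, 0 <= t <= c -> `|f j t| <= k j}.
  apply: (@choice _ _ (fun j k => 0 <= k /\
    forall t, 0 <= t <= c -> `|f j t| <= k)) => j.
  by have [K K0 HK] := bounded_itv0 bc (fc j); exists K.
exists (\sum_j k j) => [|j t tc]; first by rewrite sumr_ge0// => j _; case: (kP j).
rewrite (bigD1 j)//= ler_wpDr//; last by case: (kP j) => _; exact.
by rewrite sumr_ge0// => i _; case: (kP i).
Qed.

(** Picard iteration. The successive corrections [d n] start with the constant
initial value, and [d n.+1] is the antiderivative of [a * d n] that vanishes
at [0]. On [0, c] the bound [`|d n| <= C * 2^-n * exp (L u)] reproduces itself
from [n] to [n.+1] as soon as [L] is twice the norm of the system, since
integrating [exp (L u)] gains the factor [1 / L]. Hence the series of the [d n]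
converges uniformly on compact intervals; its sum [y] is continuous, and
[y0] plus the antiderivative of [a * y] is a limit of the same partial sums.
No solution on an interval [0, c] has to be extended, because the [d n] live on
the whole of [0, b) and only the bounds depend on [c]. *)
Lemma linear_ode (a : I -> I -> R -> R) (y0 : I -> R) :
  (forall i j, {within itv0 b, continuous (a i j)}) ->
  exists y : I -> R -> R, (forall i, y i 0 = y0 i) /\
    forall i t, itv0 b t ->
      has_deriv (itv0 b) (y i) t (\sum_j a i j t * y j t).
Proof.
move=> ca.
have [T TP] : {T : (I -> R -> R) -> I -> R -> R & forall y,
    (forall i, {within itv0 b, continuous (y i)}) ->
    forall i, T y i 0 = 0 /\ forall t, itv0 b t ->
      has_deriv (itv0 b) (T y i) t (\sum_j a i j t * y j t)}.
  apply: (@choice _ _ (fun (y z : I -> R -> R) =>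
    (forall i, {within itv0 b, continuous (y i)}) ->
    forall i, z i 0 = 0 /\ forall t, itv0 b t ->
      has_deriv (itv0 b) (z i) t (\sum_j a i j t * y j t))) => y.
  have [cy|ncy] := pselect (forall i, {within itv0 b, continuous (y i)}); last by exists y.
  have [z zP] : {z : I -> R -> R & forall i, z i 0 = 0 /\ forall t, itv0 b t ->
      has_deriv (itv0 b) (z i) t (\sum_j a i j t * y j t)}.
    apply: (@choice _ _ (fun i z => z 0 = 0 /\ forall t, itv0 b t ->
      has_deriv (itv0 b) z t (\sum_j a i j t * y j t))) => i.
    by have [F F0 dF] := antiderivative b0 (continuous_sum (i := i) ca cy); exists F.
  by exists z.
pose d n := iter n T (fun i => cst (y0 i)).
have cd n i : {within itv0 b, continuous (d n i)}.
  elim: n i => [|n IH] i; first exact/continuous_subspaceT/cst_continuous.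
  apply: has_deriv_continuous => t bt.
  by have [_ /(_ t bt)] := TP _ IH i; exact.
have d0 n i : d n.+1 i 0 = 0 by have [] := TP _ (cd n) i.
have dd n i t : itv0 b t ->
    has_deriv (itv0 b) (d n.+1 i) t (\sum_j a i j t * d n j t).
  by move=> bt; have [_] := TP _ (cd n) i; exact.
have dle c : itv0 b c -> exists2 B, 0 <= B & forall n i t, 0 <= t <= c ->
    `|d n i t| <= B * 2^-1 ^+ n.
  move=> bc; have [K K0 aK] :=
    bounded_family (f := fun p => a p.1 p.2) bc (fun p => ca p.1 p.2).
  have c0 : 0 <= c by case: bc.
  pose C := \sum_j `|y0 j|; pose L := 2 * #|I|%:R * K.
  have C0 : 0 <= C by rewrite sumr_ge0.
  have L0 : 0 <= L by rewrite !mulr_ge0// ler0n.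
  have H n i t : 0 <= t <= c -> `|d n i t| <= C * 2^-1 ^+ n * expR (L * t).
    elim: n i t => [|n IH] i t /andP[t0 tc].
      rewrite expr0 mulr1 /d/= (@le_trans _ _ C)//.
        by rewrite /C (bigD1 i)//= lerDl sumr_ge0.
      by rewrite ler_peMr// -expR0 ler_expR mulr_ge0.
    set h := C * 2^-1 ^+ n.+1.
    have h0 : 0 <= h by rewrite mulr_ge0.
    have hE : C * 2^-1 ^+ n = 2 * h by rewrite /h exprS; lra.
    have := @has_deriv_le _ b (d n.+1 i) (fun u => h * expR (L * u))
      (fun u => \sum_j a i j u * d n j u) (fun u => h * (L * expR (L * u))) 0 t.
    rewrite d0 subr0 => {}/(_ (lexx _) t0 (itv0_le bc t0 tc)) H.
    apply: (le_trans (H _ _ _)).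
    - by move=> u /andP[u0 ut]; apply/dd/(itv0_le bc); lra.
    - by move=> u _; apply/has_derivZ/has_deriv_expM.
    - move=> u /andP[u0 ut]; apply: (le_trans (ler_norm_sum _ _ _)).
      apply: (@le_trans _ _ (\sum_(j : I) K * (2 * h * expR (L * u)))).
        apply: ler_sum => j _; rewrite normrM ler_pM//.
          by rewrite (aK (i, j))// u0 (le_trans ut).
        by rewrite -hE IH// u0 (le_trans ut).
      rewrite sumr_const -mulr_natl /L.
      by rewrite [leLHS](_ : _ = h * (2 * #|I|%:R * K * expR (L * u)))//; ring.
    - by rewrite gerBl mulr_ge0// expR_ge0.
  exists (C * expR (L * c)) => [|n i t tc]; first by rewrite mulr_ge0// expR_ge0.
  apply: (le_trans (H n i t tc)); rewrite mulrAC ler_wpM2r// ler_wpM2l//.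
  by rewrite ler_expR ler_wpM2l//; case/andP: tc.
pose S n i t := series (fun k => d k i t) n.
pose y i t := limn (fun n => S n i t).
have Scvg i t : itv0 b t -> S n i t @[n --> \oo] --> y i t.
  move=> bt; have [B B0 HB] := dle t bt.
  have t0 : 0 <= t by case: bt.
  have : cvgn (series (fun k => d k i t)).
    apply: normed_cvg.
    apply: (@series_le_cvg _ _ (geometric B 2^-1)) => [n|n|n|].
    - exact: normr_ge0.
    - by rewrite /= mulr_ge0.
    - by apply: HB; rewrite t0 lexx.
    - by apply: is_cvg_geometric_series; rewrite ger0_norm// invf_lt1// ltr1n.
  by move=> H; exact: H.
have Sle c B : (forall n i t, 0 <= t <= c -> `|d n i t| <= B * 2^-1 ^+ n) ->
    forall m n i t, 0 <= t <= c -> `|S (m + n)%N i t - S n i t| <= 2 * B * 2^-1 ^+ n.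
  move=> HB m n i t tc.
  suff : `|S (m + n)%N i t - S n i t| <= 2 * B * 2^-1 ^+ n - 2 * B * 2^-1 ^+ (m + n).
    move/le_trans; apply; rewrite gerBl -mulrA mulr_ge0//.
    by apply: le_trans (HB (m + n)%N i t tc).
  elim: m => [|m IH]; first by rewrite add0n !subrr normr0.
  rewrite addSn exprS.
  have -> : S (m + n).+1 i t = S (m + n)%N i t + d (m + n)%N i t.
    by rewrite /S /series/= big_nat_recr.
  rewrite addrAC (le_trans (ler_normD _ _))//.
  by have := HB (m + n)%N i t tc; lra.
have yle c : itv0 b c -> exists2 B, 0 <= B & forall n i t, 0 <= t <= c ->
    `|y i t - S n i t| <= B * 2^-1 ^+ n.
  move=> bc; have [B B0 HB] := dle c bc.
  exists (2 * B) => [|n i t tc]; first by rewrite mulr_ge0.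
  have bt : itv0 b t by case/andP: tc => ? ?; exact: itv0_le bc _ _.
  apply/ler_addgt0Pr => e e0.
  have /cvgrPdist_le/(_ e e0)[m _ Hm] := Scvg i t bt.
  have /Hm : (m <= m + n)%N by rewrite leq_addr.
  rewrite /= => H1; have H2 := Sle c B HB m n i t tc.
  by rewrite -(subrKA (S (m + n)%N i t)) (le_trans (ler_normD _ _))// addrC lerD.
have S1 n i t : S n.+1 i t = y0 i + series (fun k => d k.+1 i t) n.
  by rewrite /S /series/= big_nat_recl.
have dS n i t : itv0 b t ->
    has_deriv (itv0 b) (S n.+1 i) t (\sum_j a i j t * S n j t).
  move=> bt.
  have -> : S n.+1 i = (fun t => y0 i + \sum_(0 <= k < n) d k.+1 i t).
    by apply/funext => u; rewrite S1.
  have -> : \sum_j a i j t * S n j t =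
      0 + \sum_(0 <= k < n) \sum_j a i j t * d k j t.
    rewrite add0r exchange_big/=; apply: eq_bigr => j _.
    by rewrite -mulr_sumr.
  apply: has_derivD; first exact: has_deriv_cst.
  by apply: has_deriv_sum => k _; exact: dd.
have cy i : {within itv0 b, continuous (y i)}.
  apply/subspace_continuousP => t bt.
  have [c tc bc] := itv0_gt bt; have [B B0 HB] := yle c bc.
  apply/cvgrPdist_le => e e0; have e30 : 0 < e / 3 by rewrite divr_gt0.
  have [n Hn] := exists_half_exp_le e30 B0.
  have /cvgrPdist_le/(_ _ e30) := has_deriv_cvg (dS n i t bt).
  rewrite !near_withinE => H; near=> u => bu.
  have Hu : itv0 b u -> `|S n.+1 i t - S n.+1 i u| <= e / 3 by near: u.
  have uc : u < c by near: u; exact: lt_nbhsl.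
  have Hn1 : B * 2^-1 ^+ n.+1 <= e / 3.
    apply: le_trans Hn; rewrite ler_wpM2l// exprS ler_piMl ?exprn_ge0//.
    by rewrite invf_le1// ler1n.
  have t0 : 0 <= t by case: bt.
  have u0 : 0 <= u by case: bu.
  have H1 : `|y i t - S n.+1 i t| <= e / 3.
    by apply: le_trans Hn1; apply: HB; rewrite t0 ltW.
  have H2 : `|y i u - S n.+1 i u| <= e / 3.
    by apply: le_trans Hn1; apply: HB; rewrite u0 ltW.
  rewrite distrC in H2.
  rewrite -(subrKA (S n.+1 i t)) -(subrKA (S n.+1 i u) (S n.+1 i t)).
  have -> : e = e / 3 + (e / 3 + e / 3) by lra.
  rewrite (le_trans (ler_normD _ _))// lerD//.
  by rewrite (le_trans (ler_normD _ _))// lerD// Hu.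
have zP i : exists2 z : R -> R, z 0 = 0 & forall t, itv0 b t ->
    has_deriv (itv0 b) z t (\sum_j a i j t * y j t).
  exact: antiderivative b0 (continuous_sum (i := i) ca cy).
(* [S n.+1 i - z] has derivative [a * (S n - y)], which is of order [2^-n]. *)
have yE i (z : R -> R) : z 0 = 0 -> (forall t, itv0 b t ->
    has_deriv (itv0 b) z t (\sum_j a i j t * y j t)) ->
    forall t, itv0 b t -> y i t = y0 i + z t.
  move=> z0 dz t bt; have [B B0 HB] := yle t bt.
  have [K K0 aK] := bounded_family (f := fun p => a p.1 p.2) bt (fun p => ca p.1 p.2).
  have t0 : 0 <= t by case: bt.
  apply/eqP; rewrite -subr_eq0 -normr_le0; apply/ler_addgt0Pr => e e0.
  rewrite add0r.
  have C0 : 0 <= B + #|I|%:R * (K * B) * t by rewrite addr_ge0// !mulr_ge0.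
  have [n Hn] := exists_half_exp_le e0 C0.
  apply: le_trans Hn; rewrite -(subrKA (S n.+1 i t)) mulrDl.
  rewrite (le_trans (ler_normD _ _))// lerD//.
    apply: (@le_trans _ _ (B * 2^-1 ^+ n.+1)); first by apply: HB; rewrite t0 lexx.
    rewrite ler_wpM2l// exprS ler_piMl ?exprn_ge0//.
    by rewrite invf_le1// ler1n.
  have S00 : S n.+1 i 0 = y0 i.
    by rewrite S1 /series/= big1 ?addr0// => k _; exact: d0.
  set M := #|I|%:R * (K * B) * 2^-1 ^+ n.
  rewrite [leRHS](_ : _ = M * `|t - 0|); last by rewrite subr0 ger0_norm// /M; ring.
  rewrite [X in `|X|](_ : _ = (S n.+1 i t - z t) - (S n.+1 i 0 - z 0)); last first.
    by rewrite S00 z0; ring.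
  apply: (@has_deriv_lipschitz _ b (fun u => S n.+1 i u - z u)
    (fun u => \sum_j a i j u * S n j u - \sum_j a i j u * y j u)) => //.
  - rewrite min_l// max_r// => u /andP[u0 ut].
    have bu := itv0_le bt u0 ut.
    by apply: has_derivB; [exact: dS|exact: dz].
  - rewrite min_l// max_r// => u ut.
    rewrite -sumrB (le_trans (ler_norm_sum _ _ _))//.
    apply: (@le_trans _ _ (\sum_(j : I) K * (B * 2^-1 ^+ n))).
      apply: ler_sum => j _; rewrite -mulrBr normrM ler_pM//; first exact: (aK (i, j)).
      by rewrite distrC HB.
    by rewrite sumr_const -[_ *+ #|_|]mulr_natl /M !mulrA lexx.
exists y; split.
  move=> i; have [z z0 dz] := zP i.
  by rewrite (yE i z z0 dz 0 (itv0_zero b0)) z0 addr0.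
move=> i t bt; have [z z0 dz] := zP i.
have : has_deriv (itv0 b) (fun u => y0 i + z u) t (0 + \sum_j a i j t * y j t).
  by apply: has_derivD; [exact: has_deriv_cst|exact: dz].
rewrite add0r => /has_derivP H; apply/has_derivP => e e0.
apply: filterS (H e e0) => u Hu bu.
by rewrite (yE i z z0 dz u bu) (yE i z z0 dz t bt) Hu.
Unshelve. all: by end_near. Qed.

End LinearSystems.

(** * Flat linear systems in two variables *)

Section Frobenius.
Variables (R : realType) (I : finType) (b1 b2 : \bar R).
Hypotheses (b1_gt0 : (0 < b1)%E) (b2_gt0 : (0 < b2)%E).
Variables (a b a_t b_x : I -> I -> R -> R -> R).
Hypotheses (ac : forall i j, cont2 b1 b2 (a i j))
  (bc : forall i j, cont2 b1 b2 (b i j))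
  (a_tc : forall i j, cont2 b1 b2 (a_t i j)).
Hypothesis da : forall i j x t, itv0 b1 x -> itv0 b2 t ->
  has_deriv (itv0 b2) (a i j x) t (a_t i j x t).
Hypothesis db : forall i j x t, itv0 b1 x -> itv0 b2 t ->
  has_deriv (itv0 b1) ((b i j)^~ t) x (b_x i j x t).
Hypothesis flat : forall i k x t, itv0 b1 x -> itv0 b2 t ->
  a_t i k x t + \sum_j a i j x t * b j k x t =
  b_x i k x t + \sum_j b i j x t * a j k x t.

(** Flatness expresses [b_x] as a polynomial in the continuous functions [a], [b]
and [a_t]. *)
Lemma cont2_b_x i k : cont2 b1 b2 (b_x i k).
Proof.
apply/subspace_continuousP => -[x t] [/= Dx Dt].
have cvgs (f g : I -> I -> R -> R -> R) : (forall i j, cont2 b1 b2 (f i j)) ->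
    (forall i j, cont2 b1 b2 (g i j)) ->
    \sum_j f i j p.1 p.2 * g j k p.1 p.2 @[p --> within (itv0 b1 `*` itv0 b2) (nbhs (x, t))]
    --> \sum_j f i j x t * g j k x t.
  move=> fc gc; apply: cvg_big => [|j _]; first exact: add_continuous.
  by apply: cvgM; [have /subspace_continuousP := fc i j|
    have /subspace_continuousP := gc j k]; move=> /(_ (x, t)); apply.
have E x' t' : itv0 b1 x' -> itv0 b2 t' -> b_x i k x' t' =
    a_t i k x' t' + \sum_j a i j x' t' * b j k x' t' - \sum_j b i j x' t' * a j k x' t'.
  by move=> Dx' Dt'; rewrite flat// addrK.
rewrite /from_subspace/= (E x t Dx Dt).
apply: (cvg_trans (G := (a_t i k p.1 p.2 + \sum_j a i j p.1 p.2 * b j k p.1 p.2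
    - \sum_j b i j p.1 p.2 * a j k p.1 p.2)
    @[p --> within (itv0 b1 `*` itv0 b2) (nbhs (x, t))])).
  apply: fmap_within_eq => -[x' t']; rewrite inE => -[/= Dx' Dt'].
  by rewrite E.
apply: cvgB; last exact: cvgs.
apply: cvgD; last exact: cvgs.
by have /subspace_continuousP := @a_tc i k; move=> /(_ (x, t)); apply.
Qed.

(** Let [y] solve the [t]-system for every [x] and the [x]-system for [t = 0], and
put [Z = a y], [h = x' - x], [r u = y x' u - y x u - h * Z x u]. By flatness
[Z' = a_t y + a b y = b_x y + b Z], hence
[r' = b x' r + (b x' - b x - h b_x) y + h (b x' - b x) Z]. The last two terms
are [o(h)] uniformly in [u], and so is the initial value [r 0] by the
[x]-system on [t = 0]; the Gronwall inequality gives [r = o(h)], which says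
that [y] has the derivative [Z] in [x]. Differentiability of [y] in [x] is a
conclusion of this estimate, not an input. *)
Lemma frobenius_x (y : I -> R -> R -> R) :
  (forall i x, itv0 b1 x ->
     has_deriv (itv0 b1) ((y i)^~ 0) x (\sum_j a i j x 0 * y j x 0)) ->
  (forall i x t, itv0 b1 x -> itv0 b2 t ->
     has_deriv (itv0 b2) (y i x) t (\sum_j b i j x t * y j x t)) ->
  forall i x t, itv0 b1 x -> itv0 b2 t ->
    has_deriv (itv0 b1) ((y i)^~ t) x (\sum_j a i j x t * y j x t).
Proof.
move=> dy0 dy i x t Dx Dt.
have t0 : 0 <= t by case: Dt.
pose Z i u := \sum_j a i j x u * y j x u.
have yc j : {within itv0 b2, continuous (y j x)}.
  by apply: has_deriv_continuous => u Du; exact: dy.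
have Zc j : {within itv0 b2, continuous (Z j)}.
  have := @continuous_sum R I b2 (fun k l => a k l x) (fun k => y k x)
    (fun k l => cont2_t (@ac k l) Dx) yc j.
  exact.
have [By By0 yB] := bounded_family Dt yc.
have [Bz Bz0 zB] := bounded_family Dt Zc.
have [Bb Bb0 bB] := bounded_family (f := fun p => b p.1 p.2 x) Dt
  (fun p => cont2_t (@bc p.1 p.2) Dx).
have [Bx Bx0 xB] := bounded_family (f := fun p => b_x p.1 p.2 x) Dt
  (fun p => cont2_t (@cont2_b_x p.1 p.2) Dx).
have K0 : 0 <= Bb + (Bx + 1) by lra.
have [C C0 HC] := gronwall I Dt K0.
pose N : R := #|I|%:R.
have N0 : 0 <= N by rewrite ler0n.
(* [S * eta * `|h|] majorizes both the initial value and the inhomogeneity of the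
   system for the remainder, and [eta] is chosen so that [C * S * eta <= e]. *)
pose S := 1 + N * By + N * ((Bx + 1) * Bz).
have S0 : 0 <= S by rewrite !addr_ge0// !mulr_ge0// addr_ge0.
apply/has_derivP => e e0.
pose eta := Num.min 1 (e / (C * S + 1)).
have CS0 : 0 < C * S + 1 by rewrite ltr_wpDl// mulr_ge0.
have eta0 : 0 < eta by rewrite lt_min ltr01 divr_gt0.
have eta1 : eta <= 1 by rewrite ge_min lexx.
have etaE : C * S * eta <= e.
  apply: (@le_trans _ _ ((C * S + 1) * eta)); first by rewrite ler_wpM2r ?(ltW eta0)//; lra.
  by rewrite mulrC -ler_pdivlMr// ge_min lexx orbT.
have nb : \forall x' \near x, forall p : I * I, itv0 b1 x' -> forall u, 0 <= u <= t ->
    `|b p.1 p.2 x' u - b p.1 p.2 x u - (x' - x) * b_x p.1 p.2 x u| <= eta * `|x' - x|.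
  apply: (@filter_forall R (I * I)%type (fun p x' => itv0 b1 x' ->
    forall u, 0 <= u <= t -> `|b p.1 p.2 x' u - b p.1 p.2 x u
      - (x' - x) * b_x p.1 p.2 x u| <= eta * `|x' - x|) (nbhs x)) => p.
  exact: (cont2_expansion (fun x' u => @db p.1 p.2 x' u) (@cont2_b_x p.1 p.2) Dx Dt eta0).
have ny : \forall x' \near x, forall j, itv0 b1 x' ->
    `|y j x' 0 - y j x 0 - Z j 0 * (x' - x)| <= eta * `|x' - x|.
  apply: (@filter_forall R I (fun j x' => itv0 b1 x' ->
    `|y j x' 0 - y j x 0 - Z j 0 * (x' - x)| <= eta * `|x' - x|) (nbhs x)) => j.
  by have /has_derivP := dy0 j x Dx; apply.
near=> x' => Dx'.
set h := x' - x.
have hb p : forall u, 0 <= u <= t ->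
    `|b p.1 p.2 x' u - b p.1 p.2 x u - h * b_x p.1 p.2 x u| <= eta * `|h|.
  have H : forall p : I * I, itv0 b1 x' -> forall u, 0 <= u <= t ->
    `|b p.1 p.2 x' u - b p.1 p.2 x u - (x' - x) * b_x p.1 p.2 x u| <= eta * `|x' - x|.
    by near: x'.
  exact: H.
have hy j : `|y j x' 0 - y j x 0 - Z j 0 * h| <= eta * `|h|.
  have H : forall j, itv0 b1 x' ->
    `|y j x' 0 - y j x 0 - Z j 0 * (x' - x)| <= eta * `|x' - x| by near: x'.
  exact: H.
have heta : `|h| <= eta.
  rewrite /h distrC; near: x'.
  exact: (@cvgr_dist_le _ _ _ _ _ id x _ eta eta0).
(* Lipschitz bound in [x] of the coefficients, uniform on [0, t]; it also bounds
   the coefficients at [x'] independently of [x'], as [`|h| <= eta <= 1]. *)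
have hd j k u : 0 <= u <= t -> `|b j k x' u - b j k x u| <= (Bx + 1) * `|h|.
  move=> ut; have H1 := hb (j, k) u ut; have H2 := xB (j, k) u ut.
  rewrite -(subrK (h * b_x j k x u) (b j k x' u - _)).
  apply: (le_trans (ler_normD _ _)); rewrite (mulrDl Bx) [leRHS]addrC lerD//.
    by apply: (le_trans H1); rewrite ler_wpM2r.
  by rewrite normrM mulrC ler_wpM2r.
have hb' j k u : 0 <= u <= t -> `|b j k x' u| <= Bb + (Bx + 1).
  move=> ut; rewrite -(subrKC (b j k x u) (b j k x' u)).
  rewrite (le_trans (ler_normD _ _))// lerD//; first exact: (bB (j, k)).
  apply: (le_trans (hd _ _ _ ut)); rewrite ler_piMr//; first by rewrite addr_ge0.
  exact: le_trans heta eta1.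
pose r j u := y j x' u - y j x u - h * Z j u.
pose r' j u := \sum_k b j k x' u * y k x' u - \sum_k b j k x u * y k x u
  - h * \sum_k (a_t j k x u * y k x u + a j k x u * \sum_l b k l x u * y l x u).
have r'E j u : 0 <= u <= t -> r' j u = \sum_k b j k x' u * r k u
   + (\sum_k (b j k x' u - b j k x u - h * b_x j k x u) * y k x u
   + h * \sum_k (b j k x' u - b j k x u) * Z k u).
  move=> /andP[u0 ut].
  have Du : itv0 b2 u := itv0_le Dt u0 ut.
  have E : \sum_k (a_t j k x u * y k x u + a j k x u * \sum_l b k l x u * y l x u) =
      \sum_k b_x j k x u * y k x u + \sum_k b j k x u * Z k u.
    have swap (f g : I -> I -> R) : \sum_k f j k * \sum_l g k l * y l x u =
        \sum_k (\sum_l f j l * g l k) * y k x u.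
      under eq_bigr => k _ do rewrite mulr_sumr.
      rewrite exchange_big/=; apply: eq_bigr => k _.
      by rewrite mulr_suml; apply: eq_bigr => l _; rewrite mulrA.
    rewrite big_split/= (swap (fun j k => a j k x u) (fun j k => b j k x u)).
    rewrite (swap (fun j k => b j k x u) (fun j k => a j k x u)) -!big_split/=.
    by apply: eq_bigr => k _; rewrite -!mulrDl flat.
  rewrite /r' E mulrDr !mulr_sumr -!big_split/= -!sumrB.
  apply: eq_bigr => k _.
  by rewrite /r; ring.
pose e' := S * eta * `|h|.
have := HC r r' e'; have e'0 : 0 <= e' by rewrite !mulr_ge0// ltW.
move=> {}/(_ e'0) H.
have -> : y i x' t - y i x t - (\sum_j a i j x t * y j x t) * h = r i t.
  by rewrite /r mulrC.
apply: (le_trans (H _ _ _ i t _)).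
- move=> j u /andP[u0 ut]; have Du := itv0_le Dt u0 ut.
  apply: has_derivB; first by apply: has_derivB; exact: dy.
  apply: has_derivZ; apply: has_deriv_sum => k _.
  by apply: has_derivM; [exact: da|exact: dy].
- move=> j u ut; rewrite r'E// (le_trans (ler_normD _ _))// lerD//.
    rewrite (le_trans (ler_norm_sum _ _ _))// mulr_sumr ler_sum// => k _.
    by rewrite normrM ler_wpM2r// hb'.
  rewrite (le_trans (ler_normD _ _))//.
  have cN (z : R) : \sum_(k : I) z = N * z by rewrite sumr_const mulr_natl.
  have H1 : `|\sum_k (b j k x' u - b j k x u - h * b_x j k x u) * y k x u| <=
      N * (eta * `|h| * By).
    rewrite (le_trans (ler_norm_sum _ _ _))// -cN ler_sum// => k _.
    rewrite normrM ler_pM//; [exact: (hb (j, k))|exact: yB].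
  have H2 : `|h * \sum_k (b j k x' u - b j k x u) * Z k u| <=
      eta * (N * ((Bx + 1) * `|h| * Bz)).
    rewrite normrM ler_pM// (le_trans (ler_norm_sum _ _ _))// -cN ler_sum// => k _.
    rewrite normrM ler_pM//; [exact: hd|exact: zB].
  apply: (le_trans (lerD H1 H2)).
  have : 0 <= eta * `|h| by rewrite mulr_ge0// ltW.
  rewrite /e' /S; lra.
- move=> j; rewrite /r [h * _]mulrC (le_trans (hy j))// /e' -mulrA.
  rewrite ler_peMl ?mulr_ge0// ?(ltW eta0)// /S -addrA lerDl.
  by rewrite addr_ge0// !mulr_ge0// addr_ge0.
- by rewrite t0 lexx.
- by rewrite /e' !mulrA ler_wpM2r.
Unshelve. all: by end_near. Qed.

(** The solution is carried along the edge [t = 0] first and then along each line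
[x = const]. *)
Lemma frobenius (y0 : I -> R) : exists y : I -> R -> R -> R,
  (forall i, y i 0 0 = y0 i) /\
  forall i x t, itv0 b1 x -> itv0 b2 t ->
    has_deriv (itv0 b1) ((y i)^~ t) x (\sum_j a i j x t * y j x t) /\
    has_deriv (itv0 b2) (y i x) t (\sum_j b i j x t * y j x t).
Proof.
have D20 := itv0_zero b2_gt0; have D10 := itv0_zero b1_gt0.
have [w [w0 dw]] := linear_ode b1_gt0 y0 (a := fun i j x => a i j x 0)
  (fun i j => cont2_x (@ac i j) D20).
have [v vP] : {v : R -> I -> R -> R & forall x, itv0 b1 x ->
    (forall i, v x i 0 = w i x) /\ forall i t, itv0 b2 t ->
      has_deriv (itv0 b2) (v x i) t (\sum_j b i j x t * v x j t)}.
  apply: (@choice _ _ (fun x (v : I -> R -> R) => itv0 b1 x ->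
    (forall i, v i 0 = w i x) /\ forall i t, itv0 b2 t ->
      has_deriv (itv0 b2) (v i) t (\sum_j b i j x t * v j t))) => x.
  have [Dx|nDx] := pselect (itv0 b1 x); last by exists (fun _ _ => 0).
  have [v [v0 dv]] := linear_ode b2_gt0 (w^~ x) (a := fun i j => b i j x)
    (fun i j => cont2_t (@bc i j) Dx).
  by exists v.
exists (fun i x t => v x i t); split.
  by move=> i; have [-> _] := vP 0 D10; rewrite w0.
move=> i x t Dx Dt; split; last by have [_] := vP x Dx; exact.
apply: (@frobenius_x (fun i x t => v x i t)) => // {i x t Dx Dt}.
  move=> i x Dx; have /has_derivP H := dw i x Dx; apply/has_derivP => e e0.
  apply: filterS (H e e0) => x' Hx' Dx'.
  have [-> _] := vP x Dx; have [-> _] := vP x' Dx'.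
  have -> : \sum_j a i j x 0 * v x j 0 = \sum_j a i j x 0 * w j x.
    by apply: eq_bigr => j _; have [-> _] := vP x Dx.
  exact: Hx'.
by move=> i x t Dx Dt; have [_] := vP x Dx; exact.
Qed.

End Frobenius.

(** * Substituting a matrix for the spectral parameter *)

(** A polynomial with matrix coefficients that vanishes at every scalar has zero
coefficients, so [z] may be replaced by a matrix [A] acting from the other
side. The terms are indexed by an arbitrary finite type with degrees [d], which
accommodates the products of two pencils without collecting equal powers. *)
Lemma pencil_eq0_subst (F : closedFieldType) (m n p : nat) (T : finType)
    (d : T -> nat) (M : T -> 'M[F]_(p, m)) (A : 'M[F]_n) (P : 'M[F]_(n, p)) :
  (forall z : F, \sum_u z ^+ d u *: M u = 0) ->
  \sum_u A ^+ d u *m P *m M u = 0.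
Proof.
move=> M0.
have coef0 k : \sum_(u | d u == k) M u = 0.
  apply/matrixP => i j; rewrite summxE mxE.
  pose f : {poly F} := \sum_u M u i j *: 'X^(d u).
  have f0 : f = 0.
    apply/eqP; apply: contraT => /closed_nonrootP[z]; rewrite /root => /negP[].
    apply/eqP; rewrite /f horner_sum.
    have /matrixP/(_ i j) := M0 z; rewrite summxE mxE; apply: etrans.
    by apply: eq_bigr => u _; rewrite hornerZ hornerXn mxE mulrC.
  have := coef0 F k; rewrite -f0 /f coef_sum => E.
  rewrite big_mkcond/= -[RHS]E; apply: eq_bigr => u _.
  by rewrite coefZ coefXn eq_sym; case: eqP; rewrite ?mulr1 ?mulr0.
pose N := (\max_u d u).+1.
have dN u : (d u < N)%N by rewrite ltnS leq_bigmax.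
rewrite (partition_big (fun u => Ordinal (dN u)) xpredT)//=.
rewrite big1// => k _.
rewrite (eq_bigr (fun u => A ^+ k *m P *m M u)) => [|u /eqP <-//].
rewrite -mulmx_sumr (eq_bigl (fun u => d u == k)) => [|u]; last by rewrite -val_eqE.
by rewrite coef0 mulmx0.
Qed.

(** * Real coordinates of complex matrices *)

Section RealCoordinates.
Variable R : realType.
Implicit Types (z w : Cplx R) (c : bool).

(** Imaginary part for [true], real part for [false]: a boolean index lets one
coordinate family cover both. *)
Definition part c z : R := if c then complex.Im (z : R[i]) else complex.Re (z : R[i]).
Definition cunit c : Cplx R := if c then ('i)%C : R[i] else 1.

Lemma partD c z w : part c (z + w) = part c z + part c w.
Proof. by case: c; case: z => a b; case: w. Qed.

Lemma partB c z w : part c (z - w) = part c z - part c w.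
Proof. by case: c; case: z => a b; case: w. Qed.

Lemma part0 c : part c 0 = 0.
Proof. by case: c. Qed.

Lemma part_sum c (T : Type) (r : seq T) (P : pred T) (f : T -> Cplx R) :
  part c (\sum_(i <- r | P i) f i) = \sum_(i <- r | P i) part c (f i).
Proof. by apply: big_morph; [exact: partD|exact: part0]. Qed.

Lemma part_realC c (r : R) z : part c (realC r * z) = r * part c z.
Proof. by case: c; case: z => a b /=; rewrite ?mul0r ?subr0 ?addr0. Qed.

Lemma part_decomp z : z = \sum_c realC (part c z) * cunit c.
Proof.
rewrite big_bool/= mulr1; case: z => a b; apply/eqP; rewrite eq_complex/=.
by rewrite !(mulr0, mulr1, oppr0, add0r, addr0) !eqxx.
Qed.

Lemma part_inj z w : (forall c, part c z = part c w) -> z = w.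
Proof. by move=> H; rewrite [z]part_decomp [w]part_decomp; apply: eq_bigr => c _; rewrite H. Qed.

Lemma partM c z w : part c (z * w) = \sum_c' part c (z * cunit c') * part c' w.
Proof.
rewrite {1}[w]part_decomp mulr_sumr part_sum; apply: eq_bigr => c' _.
by rewrite mulrCA part_realC mulrC.
Qed.

Lemma part_cunit c c' : part c (cunit c') = (c == c')%:R.
Proof. by case: c; case: c'. Qed.

Lemma part_le_norm c z (e : R) : `|z| < realC e -> `|part c z| < e.
Proof.
rewrite normc_def ltcR => H; apply: le_lt_trans H.
rewrite -sqrtr_sqr ler_sqrt ?addr_ge0 ?sqr_ge0//.
by case: c; rewrite /= ?lerDl ?lerDr sqr_ge0.
Qed.

Lemma norm_lt_part z (e : R) : (forall c, `|part c z| < e / 2) -> `|z| < realC e.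
Proof.
move=> H; have := H true; have := H false; rewrite /= => H1 H2.
rewrite normc_def ltcR.
have e0 : 0 < e by have := normr_ge0 (complex.Im (z : R[i])); lra.
rewrite -(ger0_norm (ltW e0)) -sqrtr_sqr ltr_sqrt ?exprn_gt0//.
rewrite -(real_normK (num_real (complex.Re (z : R[i])))).
rewrite -(real_normK (num_real (complex.Im (z : R[i])))).
have := normr_ge0 (complex.Im (z : R[i])); have := normr_ge0 (complex.Re (z : R[i])).
move: H1 H2; set u := `|_|; set v := `|_| => H1 H2 u0 v0.
have : u ^+ 2 <= (e / 2) ^+ 2 by rewrite lerXn2r ?nnegrE// ltW// ?divr_gt0.
have : v ^+ 2 <= (e / 2) ^+ 2 by rewrite lerXn2r ?nnegrE// ltW// ?divr_gt0.
have : 0 < e * e by rewrite mulr_gt0.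
by rewrite !expr2; lra.
Qed.

(** Convergence of complex matrices is convergence of all real coordinates, which
reduces the matrix calculus to that of real functions. *)
Lemma mx_cvgP (T : Type) (F : set_system T) {FF : Filter F} (p q : nat)
    (f : T -> 'M[Cplx R]_(p, q)) (L : 'M[Cplx R]_(p, q)) :
  f u @[u --> F] --> L <->
  forall i j c, part c (f u i j) @[u --> F] --> part c (L i j).
Proof.
split=> [/cvg_ballP H i j c|H].
  apply/cvgrPdist_lt => e e0.
  have re0 : 0 < realC e by rewrite /realC ltcR.
  apply: filterS (H _ re0) => u [_ /(_ i j)]; rewrite /ball/= => Hu.
  by have := part_le_norm c Hu; rewrite partB.
apply/cvg_ballP => e; rewrite ltcE/= => /andP[/eqP ei er].
have eE : e = realC (complex.Re (e : R[i])).
  by apply/eqP; rewrite eq_complex/= ei !eqxx.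
have e20 : 0 < complex.Re (e : R[i]) / 2 by rewrite divr_gt0.
have : \forall u \near F, forall s : 'I_p * 'I_q * bool,
    `|part s.2 (L s.1.1 s.1.2) - part s.2 (f u s.1.1 s.1.2)| < complex.Re (e : R[i]) / 2.
  apply: (@filter_forall T ('I_p * 'I_q * bool)%type (fun s u =>
    `|part s.2 (L s.1.1 s.1.2) - part s.2 (f u s.1.1 s.1.2)| < complex.Re (e : R[i]) / 2) F).
  by move=> s; have /cvgrPdist_lt := H s.1.1 s.1.2 s.2; apply.
apply: filterS => u Hu; split; first by rewrite eE ltcR.
move=> i j; rewrite /ball/= eE; apply: norm_lt_part => c.
by rewrite partB; exact: (Hu (i, j, c)).
Qed.
End RealCoordinates.

Section MatrixCoordinates.
Variables (R : realType) (n m : nat).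
Implicit Types (P : 'M[Cplx R]_(n, m)) (u v : 'I_n * 'I_m * bool).

Definition coord u P : R := part u.2 (P u.1.1 u.1.2).
Definition basis v : 'M[Cplx R]_(n, m) := cunit R v.2 *: delta_mx v.1.1 v.1.2.

Lemma coordD u P P' : coord u (P + P') = coord u P + coord u P'.
Proof. by rewrite /coord mxE partD. Qed.

Lemma coordZ u (r : R) P : coord u (realC r *: P) = r * coord u P.
Proof. by rewrite /coord mxE part_realC. Qed.

Lemma coordB u P P' : coord u (P - P') = coord u P - coord u P'.
Proof. by rewrite /coord !mxE partB. Qed.

Lemma coord_sum u (T : Type) (r : seq T) (p : pred T) (f : T -> 'M[Cplx R]_(n, m)) :
  coord u (\sum_(i <- r | p i) f i) = \sum_(i <- r | p i) coord u (f i).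
Proof. by rewrite /coord summxE part_sum. Qed.

Lemma coord_inj P P' : (forall u, coord u P = coord u P') -> P = P'.
Proof.
by move=> H; apply/matrixP => i j; apply: part_inj => c; exact: (H (i, j, c)).
Qed.

Lemma coord_basis u v : coord u (basis v) = (u == v)%:R.
Proof.
case: u v => [[i j] c] [[i' j'] c']; rewrite /coord /basis /= !mxE.
rewrite -!pair_eqE/= /pair_eq/= -!pair_eqE/= /pair_eq/=.
case: (i == i') (j == j') => [] [] /=; rewrite ?mulr1 ?mulr0 ?part0 ?part_cunit//.
Qed.

Lemma coord_decomp (y : 'I_n * 'I_m * bool -> R) u :
  coord u (\sum_v realC (y v) *: basis v) = y u.
Proof.
rewrite coord_sum (bigD1 u)//= coordZ coord_basis eqxx mulr1 big1 ?addr0// => v vu.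
by rewrite coordZ coord_basis eq_sym (negbTE vu) mulr0.
Qed.

Lemma mx_decomp P : P = \sum_v realC (coord v P) *: basis v.
Proof. by apply: coord_inj => u; rewrite coord_decomp. Qed.

(** Derivatives of a matrix function can be computed coordinatewise; properness of
the filter is what identifies the limit. *)
Lemma coord_deriv (D : set R) (f : R -> 'M[Cplx R]_(n, m)) x L :
  ProperFilter (within D x^') ->
  (forall u, has_deriv D (fun y => coord u (f y)) x (coord u L)) ->
  derivable_in D f x /\ derive_in D f x = L.
Proof.
move=> FF H.
have fL : slope f x y @[y --> within D x^'] --> L.
  apply/mx_cvgP => i j c; have := H (i, j, c).
  rewrite /has_deriv (_ : (fun y => _) = fun y => part c (slope f x y i j))//.
  by apply/funext => y; rewrite -coordB mulrC -coordZ.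
by split; [exact: cvgP fL|exact: cvg_lim fL].
Qed.

Lemma derivable_in_cvg (D : set R) (f : R -> 'M[Cplx R]_(n, m)) x :
  derivable_in D f x -> slope f x y @[y --> within D x^'] --> derive_in D f x.
Proof. by []. Qed.

End MatrixCoordinates.

(** * The operators of the auxiliary systems *)

Section PencilOperator.
Variables (R : realType) (n m d : nat) (A : 'M[Cplx R]_n).
Implicit Types (M N : 'I_d.+1 -> 'M[Cplx R]_m) (P : 'M[Cplx R]_(n, m)).

Definition pencil_op M P : 'M[Cplx R]_(n, m) := \sum_(k < d.+1) A ^+ k *m P *m M k.

(** The coordinates of [pencil_op M] form a real square matrix acting on the
coordinates of [P]; this turns the matrix equations into real linear systems. *)
Lemma coord_pencil_op u M P : coord u (pencil_op M P) =
  \sum_v coord u (pencil_op M (basis R v)) * coord v P.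
Proof.
rewrite {1}[P]mx_decomp.
have -> : pencil_op M (\sum_v realC (coord v P) *: basis R v) =
    \sum_v realC (coord v P) *: pencil_op M (basis R v).
  under [RHS]eq_bigr => v _ do rewrite scaler_sumr.
  rewrite exchange_big/=; apply: eq_bigr => k _.
  rewrite mulmx_sumr mulmx_suml; apply: eq_bigr => v _.
  by rewrite -scalemxAr -scalemxAl.
by rewrite coord_sum; apply: eq_bigr => v _; rewrite coordZ mulrC.
Qed.

Lemma coord_pencil_op_cvg (T : Type) (F : set_system T) {FF : Filter F}
    (M : T -> 'I_d.+1 -> 'M[Cplx R]_m) (L : 'I_d.+1 -> 'M[Cplx R]_m) u P :
  (forall k, M y k @[y --> F] --> L k) ->
  coord u (pencil_op (M y) P) @[y --> F] --> coord u (pencil_op L P).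
Proof.
move=> ML.
have E N : coord u (pencil_op N P) =
    \sum_(k < d.+1) \sum_(l < m) \sum_(c : bool)
    part u.2 ((A ^+ k *m P) u.1.1 l * cunit R c) * part c (N k l u.1.2).
  rewrite coord_sum; apply: eq_bigr => k _; rewrite /coord mxE part_sum.
  by apply: eq_bigr => l _; rewrite partM.
rewrite E; under eq_fun do rewrite E.
apply: cvg_big => [|k _]; first exact: add_continuous.
apply: cvg_big => [|l _]; first exact: add_continuous.
apply: cvg_big => [|c _]; first exact: add_continuous.
by apply: cvgMr; have /mx_cvgP := ML k; exact.
Qed.

(** By linearity in [M], the difference quotient of the operator is the operator of
the difference quotients. *)
Lemma has_deriv_pencil_op (D : set R) (M : R -> 'I_d.+1 -> 'M[Cplx R]_m) x u P :
  (forall k, derivable_in D (M^~ k) x) ->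
  has_deriv D (fun y => coord u (pencil_op (M y) P)) x
    (coord u (pencil_op (fun k => derive_in D (M^~ k) x) P)).
Proof.
move=> dM.
rewrite /has_deriv (_ : (fun y => _) =
    fun y => coord u (pencil_op (fun k => slope (M^~ k) x y) P)).
  exact: (@coord_pencil_op_cvg _ (within D x^') _ (fun y k => slope (M^~ k) x y)
    _ u P (fun k => derivable_in_cvg (dM k))).
apply/funext => y.
rewrite -coordB mulrC -coordZ /pencil_op -sumrB scaler_sumr; congr coord.
by apply: eq_bigr => k _; rewrite -mulmxBr scalemxAr.
Qed.

End PencilOperator.

(** * From zero curvature to compatibility *)

Section ZeroCurvature.
Variables (R : realType).
Local Notation C := (Cplx R).

(** The pencils themselves are instances of the operator, at a scalar matrix. *)
Lemma pencil_op_scalar (m d : nat) (z : C) (M : 'I_d.+1 -> 'M[C]_m) :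
  pencil_op z%:M M 1%:M = \sum_(k < d.+1) z ^+ k *: M k.
Proof.
have zX k : (z%:M : 'M[C]_m) ^+ k = (z ^+ k)%:M.
  by elim: k => [//|k IH]; rewrite !exprS IH scalar_mxM mulmxE.
by apply: eq_bigr => k _; rewrite mulmx1 zX mul_scalar_mx.
Qed.

Lemma pencil_op_comp (n m r s : nat) (A : 'M[C]_n) (M : 'I_r.+1 -> 'M[C]_m)
    (N : 'I_s.+1 -> 'M[C]_m) (P : 'M[C]_(n, m)) :
  pencil_op A M (pencil_op A N P) =
  \sum_(p : 'I_r.+1 * 'I_s.+1) A ^+ (p.1 + p.2) *m P *m (N p.2 *m M p.1).
Proof.
rewrite -(pair_bigA _ (fun (k : 'I_r.+1) (l : 'I_s.+1) => A ^+ (k + l) *m P *m (N l *m M k)))/=.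
apply: eq_bigr => k _; rewrite /pencil_op mulmx_sumr mulmx_suml.
apply: eq_bigr => l _; rewrite exprD !mulmxA mulmxE//.
Qed.

Lemma derive_in_neg_pencil (m d : nat) (D : set R) (M : R -> 'I_d.+1 -> 'M[C]_m) x z :
  ProperFilter (within D x^') -> (forall k, derivable_in D (M^~ k) x) ->
  derive_in D (fun y => - \sum_(k < d.+1) z ^+ k *: M y k) x =
  - \sum_(k < d.+1) z ^+ k *: derive_in D (M^~ k) x.
Proof.
move=> FF dM; apply: (coord_deriv FF _).2 => u.
have N1 (X : 'M[C]_m) : - X = realC (-1) *: X by rewrite /realC rmorphN1 scaleN1r.
rewrite N1 -pencil_op_scalar coordZ.
under eq_fun do rewrite N1 -pencil_op_scalar coordZ.
by apply: has_derivZ; exact: has_deriv_pencil_op.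
Qed.

Variables (n m r s : nat) (b1 b2 : \bar R).
Variables (q : 'I_r.+1 -> R -> R -> 'M[C]_m) (Q : 'I_s.+1 -> R -> R -> 'M[C]_m).
Hypothesis q_derivable : forall k x t, itv0 b1 x -> itv0 b2 t ->
  derivable_in (itv0 b2) (fun t' => q k x t') t.
Hypothesis Q_derivable : forall k x t, itv0 b1 x -> itv0 b2 t ->
  derivable_in (itv0 b1) (fun x' => Q k x' t) x.
Hypothesis zcc : zero_curvature (itv0 b1) (itv0 b2) (neg_pencil q) (neg_pencil Q).

(** Up to sign, the left-hand side of the zero curvature equation is one pencil in
[z], in which [A] then replaces [z]. The coefficients multiply [P] from the
right, so composing the operators reverses the order of the coefficients; this
is why the commutator enters with the right sign. *)
Lemma pencil_op_flat (A : 'M[C]_n) x t (P : 'M[C]_(n, m)) : itv0 b1 x -> itv0 b2 t ->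
  pencil_op A (fun k => derive_in (itv0 b2) (q k x) t) P
    + pencil_op A (fun k => q k x t) (pencil_op A (fun k => Q k x t) P) =
  pencil_op A (fun k => derive_in (itv0 b1) ((Q k)^~ t) x) P
    + pencil_op A (fun k => Q k x t) (pencil_op A (fun k => q k x t) P).
Proof.
move=> Dx Dt.
pose T := ('I_r.+1 + ('I_s.+1 + 'I_r.+1 * 'I_s.+1))%type.
pose d (u : T) : nat := match u with
  | inl k => k | inr (inl l) => l | inr (inr (k, l)) => (k + l)%N end.
pose M (u : T) : 'M[C]_m := match u with
  | inl k => derive_in (itv0 b2) (q k x) t
  | inr (inl l) => - derive_in (itv0 b1) ((Q l)^~ t) x
  | inr (inr (k, l)) => Q l x t *m q k x t - q k x t *m Q l x t end.
have swap (f : 'I_s.+1 -> 'I_r.+1 -> 'M[C]_(n, m)) :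
    \sum_(p : 'I_s.+1 * 'I_r.+1) f p.1 p.2 = \sum_(p : 'I_r.+1 * 'I_s.+1) f p.2 p.1.
  by rewrite -pair_bigA exchange_big pair_bigA.
have : forall z : C, \sum_u z ^+ d u *: M u = 0.
  move=> z; apply/eqP; rewrite -oppr_eq0; apply/eqP; apply: etrans (zcc z Dx Dt).
  rewrite !big_sumType/=.
  have -> : derive_in (itv0 b2) (fun t' => neg_pencil q x t' z) t =
      - \sum_(k < r.+1) z ^+ k *: derive_in (itv0 b2) (q k x) t.
    apply: (derive_in_neg_pencil (M := fun t' k => q k x t')).
      exact: itv0_dnbhs_proper.
    by move=> k; exact: q_derivable.
  have -> : derive_in (itv0 b1) (fun x' => neg_pencil Q x' t z) x =
      - \sum_(k < s.+1) z ^+ k *: derive_in (itv0 b1) ((Q k)^~ t) x.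
    apply: (derive_in_neg_pencil (M := fun x' k => Q k x' t)).
      exact: itv0_dnbhs_proper.
    by move=> k; exact: Q_derivable.
  rewrite !opprD -addrA; congr (_ + _); congr (_ + _).
    by rewrite opprK -sumrN; apply: eq_bigr => k _; rewrite scalerN opprK.
  rewrite /mxcomm /neg_pencil !mulNmx !mulmxN !opprK.
  rewrite (eq_bigr (fun p : 'I_r.+1 * 'I_s.+1 =>
    z ^+ (p.1 + p.2) *: (Q p.2 x t *m q p.1 x t - q p.1 x t *m Q p.2 x t))); last by case.
  rewrite -sumrN !mulmx_suml.
  under [X in _ = X - _]eq_bigr => k _ do rewrite mulmx_sumr.
  under [X in _ = _ - X]eq_bigr => k _ do rewrite mulmx_sumr.
  rewrite [X in _ = _ - X]exchange_big/= !pair_bigA/= -sumrB.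
  apply: eq_bigr => -[k l] _ /=.
  by rewrite -!scalemxAl -!scalemxAr !scalerA -!exprD (addnC l) -scalerBr -scalerN opprB.
move/(pencil_eq0_subst A P).
rewrite !big_sumType/= -/(pencil_op A (fun k => derive_in (itv0 b2) (q k x) t) P).
rewrite !pencil_op_comp.
rewrite (swap (fun (l : 'I_s.+1) (k : 'I_r.+1) => A ^+ (l + k) *m P *m (q k x t *m Q l x t))).
rewrite (eq_bigr (fun k : 'I_s.+1 => - (A ^+ k *m P *m derive_in (itv0 b1) ((Q k)^~ t) x)));
  last by move=> k _; rewrite mulmxN.
rewrite sumrN -/(pencil_op A (fun k => derive_in (itv0 b1) ((Q k)^~ t) x) P).
rewrite (eq_bigr (fun p : 'I_r.+1 * 'I_s.+1 =>
    A ^+ (p.1 + p.2) *m P *m (Q p.2 x t *m q p.1 x t)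
    - A ^+ (p.2 + p.1) *m P *m (q p.1 x t *m Q p.2 x t))); last first.
  by move=> [k l] _ /=; rewrite mulmxBr (addnC l).
rewrite sumrB => H; apply/eqP; rewrite -subr_eq0; apply/eqP; apply: etrans H.
by rewrite opprD addrACA -addrA.
Qed.

End ZeroCurvature.

Theorem proposition4p4 (R : realType) (m n r s : nat) (b1 b2 : \bar R)
  (hb1 : (0 < b1)%E) (hb2 : (0 < b2)%E)
  (q : 'I_r.+1 -> R -> R -> 'M[Cplx R]_m)
  (Q : 'I_s.+1 -> R -> R -> 'M[Cplx R]_m)
  (q_derivable : forall k x t, itv0 b1 x -> itv0 b2 t ->
     derivable_in (itv0 b2) (fun t' => q k x t') t)
  (Q_derivable : forall k x t, itv0 b1 x -> itv0 b2 t ->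
     derivable_in (itv0 b1) (fun x' => Q k x' t) x)
  (q_continuous : forall k, jointly_continuous (itv0 b1) (itv0 b2) (q k))
  (Q_continuous : forall k, jointly_continuous (itv0 b1) (itv0 b2) (Q k))
  (qt_continuous : forall k, jointly_continuous (itv0 b1) (itv0 b2)
     (fun x t => derive_in (itv0 b2) (fun t' => q k x t') t))
  (zcc : zero_curvature (itv0 b1) (itv0 b2) (neg_pencil q) (neg_pencil Q))
  (A1 : 'M[Cplx R]_n) :
  compatible (itv0 b1) (itv0 b2)
    (fun x t (P : 'M[Cplx R]_(n, m)) =>
       \sum_(k < r.+1) A1 ^+ k *m P *m q k x t)
    (fun x t (P : 'M[Cplx R]_(n, m)) =>
       \sum_(k < s.+1) A1 ^+ k *m P *m Q k x t).
Proof.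
move=> P0.
pose E := @basis R n m.
pose a u v x t := coord u (pencil_op A1 (fun k => q k x t) (E v)).
pose b u v x t := coord u (pencil_op A1 (fun k => Q k x t) (E v)).
pose a_t u v x t := coord u (pencil_op A1
  (fun k => derive_in (itv0 b2) (fun t' => q k x t') t) (E v)).
pose b_x u v x t := coord u (pencil_op A1
  (fun k => derive_in (itv0 b1) (fun x' => Q k x' t) x) (E v)).
have cont d (M : 'I_d.+1 -> R -> R -> 'M[Cplx R]_m) :
    (forall k, jointly_continuous (itv0 b1) (itv0 b2) (M k)) ->
    forall u v, cont2 b1 b2 (fun x t => coord u (pencil_op A1 (fun k => M k x t) (E v))).
  move=> Mc u v; apply/subspace_continuousP => p Dp.
  apply: (coord_pencil_op_cvg (M := fun p k => M k p.1 p.2)) => k.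
  by have /subspace_continuousP := Mc k; apply.
have ac u v : cont2 b1 b2 (a u v) by exact: cont.
have bc u v : cont2 b1 b2 (b u v) by exact: cont.
have a_tc u v : cont2 b1 b2 (a_t u v) by exact: cont.
have da u v x t : itv0 b1 x -> itv0 b2 t -> has_deriv (itv0 b2) (a u v x) t (a_t u v x t).
  move=> Dx Dt; apply: (has_deriv_pencil_op (M := fun t' k => q k x t')) => k.
  exact: q_derivable.
have db u v x t : itv0 b1 x -> itv0 b2 t ->
    has_deriv (itv0 b1) ((b u v)^~ t) x (b_x u v x t).
  move=> Dx Dt; apply: (has_deriv_pencil_op (M := fun x' k => Q k x' t)) => k.
  exact: Q_derivable.
have flat u w x t : itv0 b1 x -> itv0 b2 t ->
    a_t u w x t + \sum_v a u v x t * b v w x t =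
    b_x u w x t + \sum_v b u v x t * a v w x t.
  move=> Dx Dt; rewrite /a /b -!coord_pencil_op -!coordD; congr coord.
  exact: (pencil_op_flat q_derivable Q_derivable zcc).
have [y [y0 dy]] := frobenius hb1 hb2 ac bc a_tc da db flat (fun u => coord u P0).
pose P x t := \sum_v realC (y v x t) *: E v.
have Py u x t : coord u (P x t) = y u x t by exact: coord_decomp.
exists P; split; first by apply: coord_inj => u; rewrite Py y0.
move=> x t Dx Dt.
have FFx := itv0_dnbhs_proper Dx; have FFt := itv0_dnbhs_proper Dt.
have [dPx Px] : derivable_in (itv0 b1) (P^~ t) x /\
    derive_in (itv0 b1) (P^~ t) x = pencil_op A1 (fun k => q k x t) (P x t).
  apply: coord_deriv => u; rewrite coord_pencil_op; under eq_fun do rewrite Py.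
  under eq_bigr => v _ do rewrite Py.
  exact: (dy u x t Dx Dt).1.
have [dPt Pt] : derivable_in (itv0 b2) (P x) t /\
    derive_in (itv0 b2) (P x) t = pencil_op A1 (fun k => Q k x t) (P x t).
  apply: coord_deriv => u; rewrite coord_pencil_op; under eq_fun do rewrite Py.
  under eq_bigr => v _ do rewrite Py.
  exact: (dy u x t Dx Dt).2.
by split.
Qed.
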